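(* Suppose $\ell>1$. The representation of $\overline U$ on $Bot$ obtained via the isomorphism $U/U(y^{2(\ell-1)})\to\overline U$ is a Weil representation of $\overline U$ of primitive type $\overline\mu$.
   Context: Setting. $R$ is a finite commutative local principal ring of odd prime characteristic $p$, with maximal ideal $\mathfrak m$ of nilpotency degree $\ell\ge 1$ and residue field $R/\mathfrak m\cong F_q$. Let $x$ be a generator of $\mathfrak m$ and $A=R[t]/(t^2-x)=R\oplus Ry$, $y^2=x$ (ramified quadratic extension of $R$), with involution $(r+sy)^*=r-sy$ ($r,s\in R$). $A$ is a finite local principal ring with maximal ideal $\mathfrak r=Ay$ of nilpotency degree $2\ell$ and residue field $F_q$. Put $\mathfrak i=\mathfrak r^\ell=Ay^\ell$. $V$ is a free $A$-module of finite rank $m\ge 1$ and $h:V\times V\to A$ is a non-degenerate hermitian form: $h$ is bi-additive, $A$-linear in the second variable, $h(v,u)=h(u,v)^*$, and $v\mapsto h(v,-)$ is a bijection $V\to \mathrm{Hom}_A(V,A)$. $U=\{g\in \mathrm{GL}_A(V): h(gu,gv)=h(u,v)\ \forall u,v\in V\}$. Let $d:A\to R$, $d(r+sy)=2s$. Fix a primitive linear character $\lambda:R^+\to\mathbf C^\times$ (its kernel contains no non-zero ideal of $R$) and put $\mu=\lambda\circ d:A^+\to\mathbf C^\times$. Weil module. Let $T$ be a transversal for $\mathfrak iV$ in $V$. The Weil module $X$ (of type $\mu$) is the complex $U$-module with basis $\{e_v: v\in T\}$ and action $ge_v=\mu(h(gv,v'))e_{v'}$ for $g\in U$, $v,v'\in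 T$, $gv\equiv v' \bmod \mathfrak iV$. $Bot$ is the $U$-submodule of $X$ spanned by the $e_v$ with $v\in T\cap yV$. Quotients ($\ell>1$). $\overline R=R/x^{\ell-1}R$, $\overline A=A/y^{2(\ell-1)}A$ (a ramified quadratic extension of $\overline R$, with induced involution), $\overline V=V/y^{2(\ell-1)}V$, and $\overline h:\overline V\times\overline V\to\overline A$ the non-degenerate hermitian form induced by $h$; $\overline U$ is the unitary group of $\overline h$ ($\overline A$-linear isometries). $U(y^{j})=\{g\in U: gv\equiv v\bmod y^jV\ \forall v\in V\}$. The reduction map $U\to\overline U$ is a group epimorphism with kernel $U(y^{2(\ell-1)})$, and $U(y^{2(\ell-1)})$ acts trivially on $Bot$. $\overline\mu:\overline A^+\to\mathbf C^\times$ is given by $\overline\mu(a+y^{2(\ell-1)}A)=\mu(-y^2a)$; primitive means its kernel contains no non-zero ideal of $\overline A$. Weil representation. $\overline H$ is the Heisenberg group $\overline A\times\overline V$ with product $(a,v)(b,w)=(a+b+\overline h(v,w),v+w)$, on which $\overline U$ (and more generally the group of all additive automorphisms of $\overline V$ preserving $\overline h$) acts by ${}^g(a,v)=(a,gv)$. A Schrödinger representation of $\overline H$ of type $\overline\mu$ is an irreducible complex representation on which $(\overline A,0)$ acts via $\overline\mu$ and which is, up to equivalence, invariant under all additive automorphisms of $\overline V$ preserving $\overline h$. A representation $W:\overline U\to\mathrm{GL}(Y)$ is a Weil representation of type $\overline\mu$ if there is a Schrödinger representation $S:\overline H\to\mathrm{GL}(Y)$ of type $\overline\mu$ with $W(g)S(k)W(g)^{-1}=S({}^gk)$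 for all $g\in\overline U$, $k\in\overline H$. *)

(* Defs.v *)
Set Warnings "-notation-overridden,-ambiguous-paths".
From HB Require Import structures.
From mathcomp Require Import all_boot all_order all_algebra all_fingroup.
From mathcomp Require Import qpoly complex reals.

Set Implicit Arguments.
Unset Strict Implicit.
Unset Printing Implicit Defensive.

Import GRing.Theory.
Local Open Scope ring_scope.

Section LocalPrincipalRings.
Variable A : finComNzRingType.

(* Unlike [idealr_closed] of the library, this allows the unit ideal, which
   matters for [primitive_character] when A is a field. *)
Definition is_ideal (I : {set A}) : Prop :=
  0 \in I /\ forall a, {in I &, forall u v, a * u + v \in I}.

Definition principal_ideal (a : A) : {set A} := [set a * b | b : A].

Definition maximal_ideal (M : {set A}) : Prop :=
  [/\ is_ideal M, M != [set: A] &
      forall I, is_ideal I -> M \subset I -> I = M \/ I = [set: A]].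

Definition local_ring (M : {set A}) : Prop :=
  maximal_ideal M /\ forall N, maximal_ideal N -> N = M.

Definition principal_ring : Prop :=
  forall I, is_ideal I -> exists a, I = principal_ideal a.

(* M ^ k = 0, said on the products of k elements of M, which generate M ^ k. *)
Definition ideal_power_zero (M : {set A}) (k : nat) : Prop :=
  forall f : 'I_k -> A, (forall i, f i \in M) -> \prod_(i < k) f i = 0.

Definition nilpotency_degree (M : {set A}) (l : nat) : Prop :=
  ideal_power_zero M l /\ forall k, ideal_power_zero M k -> (l <= k)%N.

End LocalPrincipalRings.

Notation ramified_ext x := {poly %/ ('X^2 - x%:P)}.

Section RamifiedExtension.
Variables (R : finComNzRingType) (x : R).

(* As 'X^2 - x%:P is monic of size 3, a : ramified_ext x has degree at most 1
   and represents r + s y with r = a`_0 and s = a`_1. *)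
Definition ram_y : ramified_ext x := 'qX.

Definition ram_conj (a : ramified_ext x) : ramified_ext x :=
  qpolyC _ a`_0 - qpolyC _ a`_1 * ram_y.

Definition ram_d (a : ramified_ext x) : R := 2%:R * a`_1.

End RamifiedExtension.

(* f realizes V' as the quotient of V by N. *)
Definition quotient_map (V V' : zmodType) (N : V -> Prop) (f : V -> V') : Prop :=
  (forall w, exists v, f v = w) /\ (forall v, f v = 0 <-> N v).

Section Modules.
Variable A : comNzRingType.

Definition is_basis (V : lmodType A) (m : nat) (b : 'I_m -> V) : Prop :=
  forall v, exists! c : {ffun 'I_m -> A}, v = \sum_(i < m) c i *: b i.

(* Linear in the second variable, as opposed to the library's [hermitian]. *)
Definition hermitian_form (star : A -> A) (V : lmodType A) (h : V -> V -> A) :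
    Prop :=
  [/\ forall u u' v, h (u + u') v = h u v + h u' v,
      forall u v v', h u (v + v') = h u v + h u v',
      forall a u v, h u (a *: v) = a * h u v &
      forall u v, h v u = star (h u v)].

Definition nondegenerate_form (V : lmodType A) (h : V -> V -> A) : Prop :=
  forall f : {linear V -> A^o}, exists! v, forall w, h v w = f w.

Definition scaled (V : finLmodType A) (a : A) : {set V} := [set a *: v | v : V].

Definition congruence_transversal (V : finLmodType A) (N T : {set V}) : Prop :=
  forall v, exists! t, t \in T /\ v - t \in N.

Definition unitary (V : finLmodType A) (h : V -> V -> A) (g : {perm V}) : Prop :=
  linear g /\ forall u v, h (g u) (g v) = h u v.

Definition additive_isometry (V : finLmodType A) (h : V -> V -> A)
    (g : {perm V}) : Prop :=
  (forall u v, g (u + v) = g u + g v) /\ forall u v, h (g u) (g v) = h u v.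

Definition heis_mul (V : lmodType A) (h : V -> V -> A) (k k' : A * V) : A * V :=
  (k.1 + k'.1 + h k.2 k'.2, k.2 + k'.2).

Definition heis_act (V : finLmodType A) (g : {perm V}) (k : A * V) : A * V :=
  (k.1, g k.2).

End Modules.

Section Representations.
Variable K : realType.
Notation C := K[i].

Definition additive_character (A : zmodType) (chi : A -> C) : Prop :=
  chi 0 = 1 /\ forall a b, chi (a + b) = chi a * chi b.

Definition primitive_character (A : finComNzRingType) (chi : A -> C) : Prop :=
  additive_character chi /\
  forall I : {set A}, is_ideal I -> (forall a, a \in I -> chi a = 1) ->
    I = [set 0].

(* The group is given by its carrier, a unit element and a product. *)
Definition representation (G : Type) (carrier : G -> Prop) (one : G)
    (op : G -> G -> G) (Y : vectType C) (rho : G -> 'End(Y)) : Prop :=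
  rho one = \1%VF /\
  forall g k, carrier g -> carrier k -> rho (op g k) = (rho g \o rho k)%VF.

Definition irreducible (G : Type) (Y : vectType C) (rho : G -> 'End(Y)) : Prop :=
  (fullv : {vspace Y}) <> 0%VS /\
  forall Z : {vspace Y}, (forall k, (rho k @: Z <= Z)%VS) ->
    Z = 0%VS \/ Z = fullv.

Definition equivalent (G : Type) (Y : vectType C) (rho rho' : G -> 'End(Y)) :
    Prop :=
  exists f : 'End(Y), lker f = 0%VS /\
    forall k, (f \o rho k)%VF = (rho' k \o f)%VF.

Section Weil.
Variables (A : comNzRingType) (V : finLmodType A) (h : V -> V -> A).
Variables (mu : A -> C) (Y : vectType C).

Definition heisenberg_rep (S : A * V -> 'End(Y)) : Prop :=
  representation (fun _ => True) (0, 0) (heis_mul h) S.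

(* The library's product of permutations k * g is the composite of functions
   v |-> g (k v). *)
Definition unitary_rep (W : {perm V} -> 'End(Y)) : Prop :=
  representation (unitary h) 1%g (fun g k => (k * g)%g) W.

Definition schrodinger (S : A * V -> 'End(Y)) : Prop :=
  [/\ heisenberg_rep S, irreducible S,
      forall a, S (a, 0) = mu a *: \1%VF &
      forall g, additive_isometry h g ->
        equivalent S (fun k => S (heis_act g k))].

Definition weil_representation (W : {perm V} -> 'End(Y)) : Prop :=
  unitary_rep W /\
  exists S, schrodinger S /\
    forall g k, unitary h g ->
      (W g \o S k \o (W g)^-1)%VF = S (heis_act g k).

End Weil.

Section WeilModule.
Variables (A : comNzRingType) (V : finLmodType A) (h : V -> V -> A).
Variables (mu : A -> C) (T : {set V}).

Definition weil_module : vectType C := {ffun {v : V | v \in T} -> C^o}.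

Definition weil_basis (t : {v : V | v \in T}) : weil_module :=
  [ffun t' => (t' == t)%:R].

(* The linear extension of e_v |-> mu (h (g v) v') e_v', where v' represents
   g v modulo N. *)
Definition weil_action (N : {set V}) (g : {perm V}) (f : weil_module) :
    weil_module :=
  \sum_v \sum_(v' | g (val v) - val v' \in N)
    (f v * mu (h (g (val v)) (val v'))) *: weil_basis v'.

Definition weil_bot (N : {set V}) : {vspace weil_module} :=
  <<[seq weil_basis v | v in [pred v | val v \in N]]>>%VS.

End WeilModule.

End Representations.

(* Main.v *)
From HB Require Import structures.
Require Import Defs.
From mathcomp Require Import all_boot all_order all_algebra all_fingroup.
From mathcomp Require Import qpoly complex reals boolp.
From mathcomp Require Import ring zify.

Set Implicit Arguments.
Unset Strict Implicit.
Unset Printing Implicit Defensive.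

Import GRing.Theory Num.Theory.
Local Open Scope ring_scope.

(** For v in V write E v = mu(h(v, t)) e_t, with t in T the representative of v
    modulo y^l V.  Since y^l V is isotropic, E v = mu(h(v, v')) E v' whenever
    v = v' modulo y^l V, so each of the rules
      E v |-> E (g v)  for g in U,   E v |-> mu(h(u, v)) E (u + v)  for u in V
    defines a linear map; the former is the action of g.  Bot is spanned by the
    vectors E (y w), which depend only on the class of w in Vbar, and
    h(y u, y w) = - y^2 h(u, w) turns mu into mubar.  Hence the translations by
    the y u make Bot a representation of the Heisenberg group of type mubar,
    which the action of U intertwines.  It is irreducible because y^(l-1) Vbar
    is its own orthogonal and acts on the lines spanned by the E (y w) through
    distinct characters.
    A bijective additive isometry of a non-degenerate form is linear, hence
    unitary, so the intertwining also gives the required invariance.  Finally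
    every gbar in Ubar lifts to U: if g0 is a linear lift and
    h(g0 u, g0 v) - h(u, v) is written as h(E u, v), then g0 (1 - E / 2) is an
    isometry lifting gbar, the terms of second order in E vanishing because
    2 (l - 1) >= l. *)

(** For odd p the integer (p + 1) / 2 inverts 2. *)
Lemma odd_pchar_half (R : nzRingType) (p : nat) : p \in [pchar R] -> odd p ->
  exists half : R, half + half = 1.
Proof.
move=> /andP[_ /eqP p0] p_odd; exists (p./2.+1)%:R; rewrite -natrD.
have -> : (p./2.+1 + p./2.+1 = p + 1)%N.
  by rewrite -[in RHS](odd_double_half p) p_odd -addnn; lia.
by rewrite natrD p0 add0r.
Qed.

(** * Local principal rings and ramified extensions *)

Section LocalPrincipalRing.
Variables (R : finComNzRingType) (x : R) (l : nat).

Lemma principal_ideal_is_ideal (a : R) : is_ideal (principal_ideal a).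
Proof.
split; first by apply/imsetP; exists 0; rewrite ?mulr0.
move=> b _ _ /imsetP[u _ ->] /imsetP[v _ ->].
by apply/imsetP; exists (b * u + v) => //; ring.
Qed.

(** Finiteness replaces Zorn's lemma: a largest proper ideal containing [I] is maximal. *)
Lemma ideal_in_maximal (I : {set R}) : is_ideal I -> 1 \notin I ->
  exists2 M, maximal_ideal M & I \subset M.
Proof.
move=> idI I1.
pose P (J : {set R}) := [&& `[< is_ideal J >], 1 \notin J & I \subset J].
have PI : P I by rewrite /P I1 subxx !andbT; apply/asboolP.
case: (arg_maxnP (fun J : {set R} => #|J|) PI) => M.
move=> /and3P[/asboolP idM M1 IM] max.
exists M => //; split => // [|J idJ MJ].
  by apply: contraNneq M1 => ->; rewrite inE.
have [J1|J1] := boolP (1 \in J).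
  right; apply/setP => a; rewrite inE.
  by have := idJ.2 a 1 0 J1 idJ.1; rewrite mulr1 addr0.
left; apply/esym/eqP; rewrite eqEcard MJ; apply: max.
by rewrite /P J1 (subset_trans IM MJ) !andbT; apply/asboolP.
Qed.

Hypotheses (loc : local_ring (principal_ideal x)).
Hypotheses (nil : nilpotency_degree (principal_ideal x) l).

(** A non-unit generates a proper ideal, hence lies in the unique maximal ideal. *)
Lemma local_ring_unit (a : R) :
  (exists b, a * b = 1) \/ exists b, a = x * b.
Proof.
have [/imsetP[b _ /esym ab]|a1] := boolP (1 \in principal_ideal a).
  by left; exists b.
have [M /loc.2 -> aM] := ideal_in_maximal (principal_ideal_is_ideal a) a1.
right.
have /(subsetP aM)/imsetP[b _ ->] : a \in principal_ideal a.
  by apply/imsetP; exists 1; rewrite ?mulr1.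
by exists b.
Qed.

Lemma nilp_expr : x ^+ l = 0.
Proof.
have := nil.1 (fun=> x); rewrite prodr_const card_ord; apply => _.
by apply/imsetP; exists 1; rewrite ?mulr1.
Qed.

Lemma nilp_min k : x ^+ k = 0 -> (l <= k)%N.
Proof.
move=> xk; apply: nil.2 => f fM.
have /choice[c fE] i : exists c, f i = x * c.
  by have /imsetP[c _ ->] := fM i; exists c.
rewrite (eq_bigr _ (fun i _ => fE i)) big_split /=.
by rewrite prodr_const card_ord xk mul0r.
Qed.

(** Powers of x are split off [r] one at a time. A unit cofactor at a stage k < l - 1 would give
    x^(k+1) = 0, against the minimality of l. *)
Lemma annihilator_generator (r : R) : x * r = 0 -> exists s, r = x ^+ l.-1 * s.
Proof.
move=> xr.
suff H k : (k <= l.-1)%N -> exists s, r = x ^+ k * s by exact: H.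
elim: k => [|k IH] lek; first by exists r; rewrite mul1r.
have [s rE] := IH (ltnW lek).
have [[b sb]|[b sE]] := local_ring_unit s; last first.
  by exists b; rewrite rE sE exprSr mulrA.
have : x ^+ k.+1 = 0.
  by rewrite -[LHS]mulr1 -sb mulrA exprS -(mulrA x) -rE xr mul0r.
by move/nilp_min; lia.
Qed.

End LocalPrincipalRing.

(** * The ramified extension in the coordinates r + s y *)

Section RamifiedExtension.
Variables (R : finComNzRingType) (x : R).
Notation A := (ramified_ext x).
Notation y := (ram_y x).
Notation C := (qpolyC ('X^2 - x%:P)).
Implicit Types (a b : A).

(** [mk_monic] falls back to ['X] on polynomials that are not monic of positive degree; here it
    changes nothing. *)
Lemma mk_monic_ram : mk_monic ('X^2 - x%:P) = 'X^2 - x%:P.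
Proof.
have s : size ('X^2 - x%:P) = 3%N by rewrite size_XnsubC.
by rewrite /mk_monic s /= monicXnsubC.
Qed.

Lemma ram_yE : y = 'X :> {poly R}.
Proof. by rewrite /ram_y qpolyXE // ?size_XnsubC ?monicXnsubC. Qed.

Lemma ram_eqP a b : a`_0 = b`_0 -> a`_1 = b`_1 -> a = b.
Proof.
move=> e0 e1; apply/npolyP; case=> [|[|i]] //.
have s : (size (mk_monic ('X^2 - x%:P))).-1 = 2%N.
  by rewrite mk_monic_ram size_XnsubC.
by rewrite !big_coef_npoly // s.
Qed.

Lemma ram_coef0D a b : (a + b)`_0 = a`_0 + b`_0.
Proof. by rewrite poly_of_qpolyD coefD. Qed.

Lemma ram_coef1D a b : (a + b)`_1 = a`_1 + b`_1.
Proof. by rewrite poly_of_qpolyD coefD. Qed.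

Lemma ram_sqr_y : y ^+ 2 = C x.
Proof.
apply: val_inj.
rewrite -[LHS]/(polyn _) poly_of_qpolyX ram_yE -[RHS]/(x%:P) mk_monic_ram.
rewrite [X in Pdiv.CommonRing.rmodp X](_ : _ = 1 * ('X^2 - x%:P) + x%:P);
  last by ring.
rewrite Pdiv.RingMonic.rmodp_addl_mul_small ?monicXnsubC //.
by rewrite size_XnsubC // (leq_ltn_trans (size_polyC_leq1 _)).
Qed.

Lemma ram_smallE r s : (C r + C s * y : A) = r%:P + s%:P * 'X :> {poly R}.
Proof.
rewrite poly_of_qpolyD poly_of_qpolyM ram_yE !qpolyCE mk_monic_ram.
rewrite Pdiv.Ring.rmodp_small // size_XnsubC // mul_polyC.
by rewrite (leq_ltn_trans (size_scale_leq _ _)) // size_polyX.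
Qed.

Lemma ram_coef0 r s : (C r + C s * y)`_0 = r.
Proof. by rewrite ram_smallE coefD coefC coefMX addr0. Qed.

Lemma ram_coef1 r s : (C r + C s * y)`_1 = s.
Proof. by rewrite ram_smallE coefD coefC coefMX coefC add0r. Qed.

Lemma ramE a : a = C a`_0 + C a`_1 * y.
Proof. by apply: ram_eqP; rewrite ?ram_coef0 ?ram_coef1. Qed.

Lemma ram_mulE a b :
  a * b =
  C (a`_0 * b`_0 + x * (a`_1 * b`_1)) + C (a`_0 * b`_1 + a`_1 * b`_0) * y.
Proof.
rewrite {1}[a]ramE {1}[b]ramE !rmorphD !rmorphM /= -ram_sqr_y; ring.
Qed.

Lemma ram_coef0M a b : (a * b)`_0 = a`_0 * b`_0 + x * (a`_1 * b`_1).
Proof. by rewrite {1}ram_mulE ram_coef0. Qed.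

Lemma ram_coef1M a b : (a * b)`_1 = a`_0 * b`_1 + a`_1 * b`_0.
Proof. by rewrite {1}ram_mulE ram_coef1. Qed.

Lemma ram_coef0N a : (- a)`_0 = - a`_0.
Proof. by rewrite -coefN. Qed.

Lemma ram_coef1N a : (- a)`_1 = - a`_1.
Proof. by rewrite -coefN. Qed.

Lemma ram_conj_coef0 a : (ram_conj a)`_0 = a`_0.
Proof. by rewrite /ram_conj -mulNr -[- C _]rmorphN ram_coef0. Qed.

Lemma ram_conj_coef1 a : (ram_conj a)`_1 = - a`_1.
Proof. by rewrite /ram_conj -mulNr -[- C _]rmorphN ram_coef1. Qed.

Definition ram_coefs :=
  (ram_coef0D, ram_coef1D, ram_coef0N, ram_coef1N, ram_coef0M, ram_coef1M,
   ram_conj_coef0, ram_conj_coef1).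

Lemma ram_y0 : y`_0 = 0. Proof. by rewrite ram_yE coefX. Qed.
Lemma ram_y1 : y`_1 = 1. Proof. by rewrite ram_yE coefX. Qed.

Lemma ram_conjD a b : ram_conj (a + b) = ram_conj a + ram_conj b.
Proof. by apply: ram_eqP; rewrite !ram_coefs // opprD. Qed.

Lemma ram_conjM a b : ram_conj (a * b) = ram_conj a * ram_conj b.
Proof. by apply: ram_eqP; rewrite !ram_coefs; ring. Qed.

Lemma ram_conjK : involutive (@ram_conj R x).
Proof. by move=> a; apply: ram_eqP; rewrite !ram_coefs // opprK. Qed.

Lemma ram_conj_y : ram_conj y = - y.
Proof.
by apply: ram_eqP; rewrite !ram_coefs ?ram_y0 ?ram_y1 ?oppr0.
Qed.

Lemma ram_yX k : y ^+ (2 * k) = C (x ^+ k).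
Proof. by rewrite exprM ram_sqr_y -rmorphXn. Qed.

(** The products of a by s y and by s have y-coordinates a_0 s and a_1 s; as 2 is invertible,
    primitivity of [lambda] kills both coordinates of a. *)
Lemma ram_character_primitive (K : realType) (lambda : R -> K[i]) (half : R) :
  half * 2%:R = 1 -> primitive_character lambda ->
  forall a, (forall b, lambda (ram_d (a * b)) = 1) -> a = 0.
Proof.
move=> half2 [_ prim].
have R0 r : (forall s, lambda (2%:R * (r * s)) = 1) -> r = 0.
  move=> tr; have : 2%:R * r \in principal_ideal (2%:R * r).
    by apply/imsetP; exists 1; rewrite ?mulr1.
  rewrite (prim _ (principal_ideal_is_ideal _)).
    by rewrite inE => /eqP r0; rewrite -[r]mul1r -half2 -mulrA r0 mulr0.
  by move=> _ /imsetP[s _ ->]; rewrite -mulrA.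
move=> a tr; apply: ram_eqP; rewrite !coef0; apply: R0 => s.
  rewrite -[RHS](tr (C s * y)) /ram_d ram_coef1M !ram_coefs.
  rewrite !ram_y0 !ram_y1 qpolyCE !coefC /=; congr lambda; ring.
rewrite -[RHS](tr (C s)) /ram_d ram_coef1M qpolyCE !coefC /=.
by congr lambda; ring.
Qed.

Section Chain.
Variable l : nat.
Hypothesis l_gt0 : (0 < l)%N.
Hypothesis xl : x ^+ l = 0.
Hypothesis ann : forall r : R, x * r = 0 -> exists s, r = x ^+ l.-1 * s.

Lemma ram_y_nilp : y ^+ (2 * l) = 0.
Proof. by rewrite ram_yX xl rmorph0. Qed.

(** The coordinates of y a are x a_1 and a_0, and x^(l-1) y = y^(2l-1). *)
Lemma ram_annihilator_y a : y * a = 0 -> exists b, a = y ^+ (2 * l).-1 * b.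
Proof.
move=> ya.
have := congr1 (fun b : A => b`_0) ya; rewrite ram_coef0M ram_y0 ram_y1 mul0r.
rewrite add0r mul1r coef0 => /ann[s sE].
have := congr1 (fun b : A => b`_1) ya; rewrite ram_coef1M ram_y0 ram_y1 mul0r.
rewrite add0r mul1r coef0 => a0.
exists (C s); rewrite [a]ramE a0 sE rmorph0 add0r rmorphM /= -ram_yX.
have -> : ((2 * l).-1 = 2 * l.-1 + 1)%N by lia.
by rewrite exprD expr1; ring.
Qed.

End Chain.

End RamifiedExtension.

(** * Annihilators of the powers of y in free modules *)

Section FreeModuleAnnihilator.
Variables (A : comNzRingType) (y : A) (e : nat).
Hypothesis ann_y : forall a, y * a = 0 -> exists b, a = y ^+ e.-1 * b.

(** If y^(k+1) a = 0, then y^k a = y^(e-1) b for some b, so y^k kills a - y^(e-k-1) b and the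
    induction applies to this difference. *)
Lemma annihilator_expr k (a : A) : (k <= e)%N -> y ^+ k * a = 0 ->
  exists b, a = y ^+ (e - k) * b.
Proof.
elim: k a => [|k IH] a lek.
  by rewrite mul1r => ->; exists 0; rewrite mulr0.
rewrite exprS -mulrA => /ann_y[b yb].
have [||b' aE] := IH (a - y ^+ (e - k.+1) * b); first exact: ltnW.
  rewrite mulrBr mulrA -exprD yb; apply/eqP; rewrite subr_eq0; apply/eqP.
  by congr (_ ^+ _ * _); lia.
exists (b + y * b'); rewrite mulrDr mulrA -exprSr addrC; apply/eqP.
by rewrite -subr_eq aE; apply/eqP; congr (_ ^+ _ * _); lia.
Qed.

Variables (V : finLmodType A) (m : nat) (b : 'I_m -> V).
Hypothesis b_basis : is_basis b.

Lemma free_annihilator_expr k (v : V) : (k <= e)%N -> y ^+ k *: v = 0 ->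
  exists w, v = y ^+ (e - k) *: w.
Proof.
have [c [vE _]] := b_basis v; move=> lek yv.
(* Both the zero family and the y^k-multiple of [c] are coordinates of 0. *)
have [c0 [_ c0_uniq]] := b_basis 0.
have c00 : c0 = [ffun=> 0].
  by apply: c0_uniq; rewrite big1 // => i _; rewrite ffunE scale0r.
have yc : c0 = [ffun i => y ^+ k * c i].
  apply: c0_uniq; rewrite -[LHS]yv vE scaler_sumr.
  by apply: eq_bigr => i _; rewrite ffunE scalerA.
have /choice[d cE] i : exists d, c i = y ^+ (e - k) * d.
  by apply: annihilator_expr => //; move/ffunP/(_ i): yc; rewrite c00 !ffunE.
exists (\sum_i d i *: b i); rewrite vE scaler_sumr.
by apply: eq_bigr => i _; rewrite scalerA -cE.
Qed.

End FreeModuleAnnihilator.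

(** * Hermitian forms and lifting of isometries *)

Section HermitianTheory.
Variables (A : comNzRingType) (star : A -> A).
Hypothesis starM : forall a b, star (a * b) = star a * star b.
Variables (V : lmodType A) (h : V -> V -> A).
Hypothesis h_herm : hermitian_form star h.

Lemma hermDl u u' v : h (u + u') v = h u v + h u' v.
Proof. by case: h_herm. Qed.
Lemma hermDr u v v' : h u (v + v') = h u v + h u v'.
Proof. by case: h_herm. Qed.
Lemma hermZr a u v : h u (a *: v) = a * h u v.
Proof. by case: h_herm. Qed.
Lemma herm_sym u v : h v u = star (h u v).
Proof. by case: h_herm. Qed.
Lemma hermZl a u v : h (a *: u) v = star a * h u v.
Proof. by rewrite herm_sym hermZr starM -herm_sym. Qed.
Lemma herm0l v : h 0 v = 0.
Proof. by apply: (addrI (h 0 v)); rewrite -hermDl !addr0. Qed.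
Lemma herm0r v : h v 0 = 0.
Proof. by apply: (addrI (h v 0)); rewrite -hermDr !addr0. Qed.
Lemma hermNl u v : h (- u) v = - h u v.
Proof. by apply: (addrI (h u v)); rewrite -hermDl !subrr herm0l. Qed.
Lemma hermNr u v : h u (- v) = - h u v.
Proof. by apply: (addrI (h u v)); rewrite -hermDr !subrr herm0r. Qed.
Lemma hermBl u u' v : h (u - u') v = h u v - h u' v.
Proof. by rewrite hermDl hermNl. Qed.
Lemma hermBr u v v' : h u (v - v') = h u v - h u v'.
Proof. by rewrite hermDr hermNr. Qed.

Hypothesis h_nondeg : nondegenerate_form h.

Lemma herm_form_linear u : linear (h u : V -> A^o).
Proof. by move=> a v v'; rewrite hermDr hermZr. Qed.

Lemma herm_riesz (f : V -> A) : linear (f : V -> A^o) ->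
  exists u, forall v, h u v = f v.
Proof.
move=> lf.
pose F : {linear V -> A^o} :=
  HB.pack (f : V -> A^o) (GRing.isLinear.Build _ _ _ _ (f : V -> A^o) lf).
by have [u [uE _]] := h_nondeg F; exists u.
Qed.

Lemma herm_inj u u' : (forall v, h u v = h u' v) -> u = u'.
Proof.
move=> uu'.
pose F : {linear V -> A^o} := HB.pack (h u : V -> A^o)
  (GRing.isLinear.Build _ _ _ _ (h u : V -> A^o) (herm_form_linear u)).
have [w [_ w_uniq]] := h_nondeg F.
by rewrite -(w_uniq u) // -(w_uniq u') // => v; rewrite /= uu'.
Qed.

End HermitianTheory.

Section LiftIsometry.
Variables (A : comNzRingType) (star : A -> A).
Hypothesis starD : forall a b, star (a + b) = star a + star b.
Hypothesis starM : forall a b, star (a * b) = star a * star b.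
Hypothesis starK : involutive star.
Variables (V : finLmodType A) (h : V -> V -> A).
Hypothesis h_herm : hermitian_form star h.
Hypothesis h_nondeg : nondegenerate_form h.
Variables (m : nat) (b : 'I_m -> V).
Hypothesis b_basis : is_basis b.
Variables (Abar : comNzRingType) (piA : {rmorphism A -> Abar}).
Variables (Vbar : finLmodType Abar) (piV : {linear V -> Vbar | piA \; *:%R}).
Variable hbar : Vbar -> Vbar -> Abar.
Hypothesis piV_surj : forall w, exists v, piV v = w.
Hypothesis hbar_def : forall u v, hbar (piV u) (piV v) = piA (h u v).
Variable half : A.
Hypothesis half2 : half + half = 1.
(** Here z will be y^2 and the kernel of [piA] will be y^(2(l-1)) A. *)
Variable z : A.
Hypothesis ker_piA : forall a, piA a = 0 -> z * a = 0.
Hypothesis ann_z : forall v : V, z *: v = 0 ->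
  exists a w, piA a = 0 /\ v = a *: w.
Hypothesis ker_sqr : forall a b, piA a = 0 -> piA b = 0 -> a * b = 0.

Let piVZ a v : piV (a *: v) = piA a *: piV v.
Proof. exact: linearZ_LR. Qed.

Lemma linear_lift (gbar : {perm Vbar}) : linear gbar ->
  exists2 g : V -> V, linear g & forall v, piV (g v) = gbar (piV v).
Proof.
move=> lin.
have lD u v : gbar (u + v) = gbar u + gbar v.
  by rewrite -[u]scale1r lin !scale1r.
have l0 : gbar 0 = 0 by apply: (addrI (gbar 0)); rewrite -lD !addr0.
have lZ a v : gbar (a *: v) = a *: gbar v.
  by rewrite -[a *: v]addr0 lin l0 addr0.
have /choice[c cP] v := b_basis v.
have /choice[w wE] i := piV_surj (gbar (piV (b i))).
have cE v d : v = \sum_i d i *: b i -> c v =1 d.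
  move=> vE i; rewrite (proj2 (cP v) [ffun i => d i]) ?ffunE //.
  by rewrite vE; apply: eq_bigr => j _; rewrite ffunE.
exists (fun v => \sum_i c v i *: w i) => [a u v|v].
  rewrite scaler_sumr -big_split /=; apply: eq_bigr => i _.
  rewrite (@cE _ (fun i => a * c u i + c v i)) ?scalerDl ?scalerA //.
  rewrite {1}(cP u).1 {1}(cP v).1 scaler_sumr -big_split /=.
  by apply: eq_bigr => j _; rewrite scalerDl scalerA.
rewrite [in RHS](cP v).1 !raddf_sum (big_morph _ lD l0) /=.
by apply: eq_bigr => i _; rewrite !piVZ lZ wE.
Qed.

Lemma isometry_lift (gbar : {perm Vbar}) : unitary hbar gbar ->
  exists2 g : {perm V}, unitary h g & forall v, gbar (piV v) = piV (g v).
Proof.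
move=> [lin iso]; have [g0 g0lin g0E] := linear_lift lin.
have hDl := hermDl h_herm; have hDr := hermDr h_herm.
have hZl := hermZl starM h_herm; have hZr := hermZr h_herm.
have hsym := herm_sym h_herm.
have g0D u v : g0 (u + v) = g0 u + g0 v by rewrite -[u]scale1r g0lin !scale1r.
have g00 : g0 0 = 0 by apply: (addrI (g0 0)); rewrite -g0D !addr0.
have g0Z a v : g0 (a *: v) = a *: g0 v.
  by rewrite -[a *: v]addr0 g0lin g00 addr0.
have star1 : star 1 = 1.
  by rewrite -[RHS](starK 1) -[star 1 in RHS]mulr1 starM starK mul1r.
have star_half : star half = half.
  have : star half + star half = 1 by rewrite -starD half2.
  by move=> sh; rewrite -[LHS]mul1r -half2 mulrDl -mulrDr sh mulr1.
(* [D] is the defect of [g0] from being an isometry; [E] represents it through [h]. *)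
pose D u v := h (g0 u) (g0 v) - h u v.
have /choice[E Eh] u : exists e, forall v, h e v = D u v.
  apply: (herm_riesz h_nondeg) => a v v'; rewrite /D g0lin !hDr !hZr.
  by rewrite -[a *: _]/(a * _); ring.
have inj := herm_inj h_herm h_nondeg.
have Elin : linear E.
  move=> a u v; apply: inj => w.
  by rewrite hDl hZl !Eh /D g0lin !hDl !hZl; ring.
have Dker u v : piA (D u v) = 0.
  by rewrite rmorphB -!hbar_def !g0E iso subrr.
have star0 : star 0 = 0 by apply: (addrI (star 0)); rewrite -starD !addr0.
have starN a : star (- a) = - star a.
  by apply: (addrI (star a)); rewrite -starD !subrr.
have Dsym u v : D v u = star (D u v) by rewrite /D starD starN -!hsym.
(* As z kills the values of [D], the vector z E u is orthogonal to V; [ann_z] then makes E u a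
   multiple by an element of the kernel of [piA]. *)
have Eker u : z *: E u = 0.
  apply: inj => v.
  by rewrite (herm0l h_herm) hsym hZr hsym Eh -Dsym ker_piA ?star0.
have piE u : piV (E u) = 0.
  by have [a [w [a0 ->]]] := ann_z (Eker u); rewrite piVZ a0 scale0r.
have DE u v : D u (E v) = 0.
  have [a [w [a0 ->]]] := ann_z (Eker v).
  have -> : D u (a *: w) = a * D u w by rewrite /D g0Z !hZr; ring.
  exact: ker_sqr.
have DEl u v : D (E v) u = 0.
  by rewrite Dsym DE star0.
pose g v := g0 (v - half *: E v).
have giso u v : h (g u) (g v) = h u v.
  have DBl u1 u2 w : D (u1 - half *: u2) w = D u1 w - half * D u2 w.
    by rewrite /D -scaleNr g0D g0Z !hDl !hZl starN star_half; ring.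
  have DBr w v1 v2 : D w (v1 - half *: v2) = D w v1 - half * D w v2.
    by rewrite /D -scaleNr g0D g0Z !hDr !hZr; ring.
  have hE : h u (E v) = D u v by rewrite hsym Eh -Dsym.
  (* h(g u, g v) is [D] plus [h] at the corrected arguments; the terms of second order vanish and
     the two halves cancel [D u v]. *)
  rewrite -[LHS](subrK (h (u - half *: E u) (v - half *: E v))).
  rewrite -/(D (u - half *: E u) (v - half *: E v)) DBl !DBr DEl !DE.
  rewrite -!scaleNr !hDl !hDr !hZl !hZr Eh hE Eh DE starN star_half.
  transitivity (h u v + D u v - (half + half) * D u v); first by ring.
  by rewrite half2; ring.
have glin : linear g.
  move=> a u v; rewrite /g Elin -g0lin; congr g0.
  by rewrite scalerDr opprD addrACA scalerBr !scalerA [half * a]mulrC.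
(* Non-degeneracy makes an isometry injective, hence a permutation of the finite module. *)
have gI : injective g.
  by move=> u v guv; apply: inj => w; rewrite -giso guv giso.
exists (perm gI); first by split=> [a u v|u v]; rewrite !permE ?glin ?giso.
move=> v; rewrite permE g0E; congr (gbar _).
by rewrite raddfB /= piVZ piE scaler0 subr0.
Qed.

End LiftIsometry.

Section AdditiveIsometry.
Variables (A : comNzRingType) (V : finLmodType A) (h : V -> V -> A).
(* The semilinearity in the first variable, without naming an involution. *)
Hypothesis h_semilin :
  forall a, exists a', forall u v, h (a *: u) v = a' * h u v.
Hypothesis h_inj : forall u u', (forall v, h u v = h u' v) -> u = u'.

(** The vectors g(a u) and a g(u) pair alike with every g w, and these exhaust V. *)
Lemma additive_isometry_unitary (g : {perm V}) :
  additive_isometry h g -> unitary h g.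
Proof.
move=> [add iso]; split=> // a u v; rewrite add; congr (_ + _).
apply: h_inj => w; have [a' aE] := h_semilin a.
by rewrite -[w](permKV g) iso !aE iso.
Qed.

End AdditiveIsometry.

Section UnitaryGroup.
Variables (A : comNzRingType) (V : finLmodType A) (h : V -> V -> A).

Lemma unitary1 : unitary h 1.
Proof. by split=> [a u v|u v]; rewrite !perm1. Qed.

Lemma unitaryM g k : unitary h g -> unitary h k -> unitary h (k * g)%g.
Proof.
move=> [glin giso] [klin kiso].
by split=> [a u v|u v]; rewrite !permM ?klin ?glin ?giso ?kiso.
Qed.

Lemma unitaryV g : unitary h g -> unitary h g^-1%g.
Proof.
move=> [lin iso]; split=> [a u v|u v].
  by apply: (@perm_inj _ g); rewrite lin !permKV.
by rewrite -iso !permKV.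
Qed.

Lemma unitaryB g u v : unitary h g -> g (u - v) = g u - g v.
Proof. by move=> [lin _]; rewrite addrC -scaleN1r lin scaleN1r addrC. Qed.

Lemma unitaryZ g a v : unitary h g -> g (a *: v) = a *: g v.
Proof.
move=> gU; have g0 : g 0 = 0 by have := unitaryB 0 0 gU; rewrite !subrr.
by rewrite -[a *: v]addr0 gU.1 g0 addr0.
Qed.

End UnitaryGroup.

(** * The Weil module *)

Section AdditiveCharacter.
Variables (K : realType) (A : zmodType) (mu : A -> K[i]).
Hypothesis mu_char : additive_character mu.

Lemma charD a b : mu (a + b) = mu a * mu b. Proof. exact: mu_char.2. Qed.
Lemma char0 : mu 0 = 1. Proof. exact: mu_char.1. Qed.
Lemma charVN a : mu a * mu (- a) = 1. Proof. by rewrite -charD subrr char0. Qed.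
Lemma char_neq0 a : mu a != 0.
Proof.
apply: contraTneq (oner_neq0 (K[i])) => mua.
by rewrite -(charVN a) mua mul0r eqxx.
Qed.

Lemma char_eq a b : mu (a - b) = 1 -> mu a = mu b.
Proof. by move=> ab; rewrite -[a](subrK b) charD ab mul1r. Qed.

End AdditiveCharacter.

(** Translation by [v0] multiplies the sum by [chi v0], which differs from 1. *)
Lemma sum_character (K : realType) (V : finZmodType) (chi : V -> K[i]) v0 :
  additive_character chi -> chi v0 <> 1 -> \sum_v chi v = 0.
Proof.
move=> [_ chiD] chi1; apply/eqP.
have : (chi v0 - 1) * \sum_v chi v == 0.
  rewrite mulrBl mul1r subr_eq0 mulr_sumr [eqbRHS](reindex_inj (addrI v0)).
  by apply/eqP/eq_bigr => v _ /=; rewrite chiD.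
by rewrite mulf_eq0 subr_eq0 => /orP[/eqP|].
Qed.

Section WeilVectors.
Variables (K : realType) (A : comNzRingType) (star : A -> A).
Hypothesis starD : forall a b, star (a + b) = star a + star b.
Variables (V : finLmodType A) (h : V -> V -> A).
Hypothesis h_herm : hermitian_form star h.
Variable mu : A -> K[i].
Hypothesis mu_char : additive_character mu.
Hypothesis mu_star : forall a, star a = a -> mu a = 1.
Variables N T : {set V}.
Hypothesis N0 : 0 \in N.
Hypothesis NB : forall u v, u \in N -> v \in N -> u - v \in N.
Hypothesis N_isotropic : forall u v, u \in N -> v \in N -> h u v = 0.
Hypothesis T_transv : congruence_transversal N T.

Notation X := (weil_module K T).
Notation basis := (@weil_basis K _ V T).

Lemma transversal_ex v : exists t : {v | v \in T}, v - val t \in N.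
Proof. by have [t [[tT vt] _]] := T_transv v; exists (Sub t tT). Qed.

Definition transversal_rep v : {v | v \in T} := xchoose (transversal_ex v).
Notation rep := transversal_rep.

Lemma transversal_repP v : v - val (rep v) \in N.
Proof. exact: (xchooseP (transversal_ex v)). Qed.

Lemma transversal_rep_uniq v (t : {v | v \in T}) :
  (v - val t \in N) = (t == rep v).
Proof.
apply/idP/eqP => [vt|->]; last exact: transversal_repP.
have [t0 [_ uniq]] := T_transv v; apply: val_inj.
rewrite -(uniq (val t)); last by split => //; exact: valP.
by apply: uniq; split; [exact: valP|exact: transversal_repP].
Qed.

(* Extends the basis e_t, t in T, to all of V. *)
Definition weil_vector v : X := mu (h v (val (rep v))) *: basis (rep v).
Notation E := weil_vector.

Lemma char_herm_norm v : mu (h v v) = 1.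
Proof. by apply: mu_star; rewrite -(herm_sym h_herm). Qed.

Lemma char_herm_trace u v : mu (h u v + h v u) = 1.
Proof. by apply: mu_star; rewrite starD -!(herm_sym h_herm) addrC. Qed.

Let NN u : u \in N -> - u \in N.
Proof. by rewrite -[- u]add0r => uN; apply: NB. Qed.

Lemma weil_vector_cong v v' : v - v' \in N -> E v = mu (h v v') *: E v'.
Proof.
move=> vv'; have rE : rep v' = rep v.
  apply/esym/eqP; rewrite -transversal_rep_uniq.
  have -> : v' - val (rep v) = (v - val (rep v)) - (v - v').
    by rewrite opprB [RHS]addrC addrA subrK.
  by apply: NB => //; exact: transversal_repP.
rewrite /E rE scalerA -(charD mu_char); congr (_ *: _).
set t := val _; have tv' : t - v' \in N.
  by rewrite -opprB NN // /t -rE transversal_repP.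
apply: (char_eq mu_char).
(* In the difference of the exponents the first term vanishes by isotropy, and [mu] is trivial on
   h(v', v'), which is fixed by [star]. *)
have -> : h v t - (h v v' + h v' t) = h (v - v') (t - v') - h v' v'.
  by rewrite (hermBl h_herm) !(hermBr h_herm); ring.
rewrite N_isotropic // sub0r; apply: mu_star.
have star0 : star 0 = 0 by apply: (addrI (star 0)); rewrite -starD !addr0.
apply: (addrI (star (h v' v'))).
by rewrite -starD subrr star0 -(herm_sym h_herm) subrr.
Qed.

Lemma weil_vector_basis t : E (val t) = basis t.
Proof.
have tE : rep (val t) = t.
  by apply/esym/eqP; rewrite -transversal_rep_uniq subrr.
by rewrite /E tE char_herm_norm scale1r.
Qed.

Definition weil_extend (f : V -> X) (z : X) : X :=
  \sum_t (z t : K[i]) *: f (val t).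

Fact weil_extend_is_linear f : linear (weil_extend f).
Proof.
move=> a z z'; rewrite /weil_extend scaler_sumr -big_split /=.
by apply: eq_bigr => t _; rewrite !ffunE scalerDl scalerA.
Qed.
HB.instance Definition _ f :=
  GRing.isLinear.Build _ _ _ _ (weil_extend f) (weil_extend_is_linear f).

Lemma weil_extend_basis f t : weil_extend f (basis t) = f (val t).
Proof.
rewrite /weil_extend (bigD1 t) //= big1 => [|t' tt'].
  by rewrite ffunE eqxx scale1r addr0.
by rewrite ffunE (negPf tt') scale0r.
Qed.

(** The condition on [f] gives f v = mu(h(v, t)) f t for the representative t of v, with the scalar
    that defines [E v]. *)
Lemma weil_extendE f v :
  (forall v v', v - v' \in N -> f v = mu (h v v') *: f v') ->
  weil_extend f (E v) = f v.
Proof.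
by move=> fP; rewrite linearZ /= weil_extend_basis -fP ?transversal_repP.
Qed.

Lemma weil_action_extend (g : {perm V}) z :
  weil_action h mu N g z = weil_extend (E \o g) z.
Proof.
apply: eq_bigr => t _ /=.
rewrite (eq_bigl (pred1 (rep (g (val t))))) => [|t']; last first.
  by rewrite transversal_rep_uniq.
by rewrite big_pred1_eq /E scalerA.
Qed.

Lemma weil_action_vector (g : {perm V}) v :
  (forall u v, h (g u) (g v) = h u v) ->
  (forall u v, g (u - v) = g u - g v) -> (forall v, v \in N -> g v \in N) ->
  weil_action h mu N g (E v) = E (g v).
Proof.
move=> iso gB gN; rewrite weil_action_extend weil_extendE; first by [].
move=> u w uw; rewrite [LHS]/comp [in RHS]/comp -iso.
by apply: weil_vector_cong; rewrite -gB; apply: gN.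
Qed.

Definition weil_translation (u : V) : X -> X :=
  weil_extend (fun v => mu (h u v) *: E (u + v)).
HB.instance Definition _ u := GRing.Linear.on (weil_translation u).

Lemma weil_translation_vector u v :
  weil_translation u (E v) = mu (h u v) *: E (u + v).
Proof.
rewrite /weil_translation weil_extendE; first by [].
move=> w w' ww'.
have uww' : u + w - (u + w') \in N by rewrite opprD addrACA subrr add0r.
rewrite (weil_vector_cong uww'); move: (E _) => e.
rewrite !scalerA -!(charD mu_char); congr (_ *: _).
apply: (char_eq mu_char).
(* The two exponents differ by a norm plus a trace, both in the kernel of [mu]. *)
have -> : h u w + h (u + w) (u + w') - (h w w' + h u w') =
    h u u + (h u w + h w u).
  by rewrite (hermDl h_herm) !(hermDr h_herm); ring.
by rewrite (charD mu_char) char_herm_norm char_herm_trace mulr1.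
Qed.

End WeilVectors.

(** * Schrodinger representations *)

Section SchrodingerModel.
Variables (K : realType) (A : comNzRingType) (V : finLmodType A).
Variables (h : V -> V -> A) (mu : A -> K[i]).
Hypothesis hDl : forall u u' v, h (u + u') v = h u v + h u' v.
Hypothesis hDr : forall u v v', h u (v + v') = h u v + h u v'.
Hypothesis mu_char : additive_character mu.
Variable c : A.
Hypothesis c_isotropic : forall u v, h (c *: u) (c *: v) = 0.
Hypothesis c_lagrangian : forall w,
  (forall v, mu (h (c *: v) w + h (c *: v) w) = 1) -> exists n, w = c *: n.
Variables (Y : vectType K[i]) (e : V -> Y) (S : A * V -> 'End(Y)).
Hypothesis e0 : e 0 != 0.
(** Expresses that the [e w] span [Y]. *)
Hypothesis e_ext : forall F G : 'End(Y), (forall w, F (e w) = G (e w)) -> F = G.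
Hypothesis e_cong : forall n w, e (c *: n + w) = mu (h (c *: n) w) *: e w.
Hypothesis SE : forall k w, S k (e w) = mu (k.1 + h k.2 w) *: e (k.2 + w).

Let h0l u : h 0 u = 0.
Proof. by apply: (addrI (h 0 u)); rewrite -hDl !addr0. Qed.

Lemma schrodinger_model_rep : heisenberg_rep h S.
Proof.
split=> [|[a u] [b v] _ _]; apply: e_ext => w.
  by rewrite SE /= h0l !add0r char0 // scale1r id_lfunE.
rewrite comp_lfunE !SE linearZ /= SE scalerA -charD //=.
congr (mu _ *: e _); last by rewrite addrA.
by rewrite hDl hDr; ring.
Qed.

Lemma schrodinger_model_center a : S (a, 0) = mu a *: \1%VF.
Proof.
apply: e_ext => w; rewrite SE /= h0l addr0 add0r.
by rewrite scale_lfunE id_lfunE.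
Qed.

(** [S (0, c *: v)] scales [e w] by mu(h(c v, w)) twice, through [SE] and through [e_cong], whence
    the doubling; [chi d v] is the ratio of its eigenvalues at w + d and at w. *)
Let chi (d v : V) := mu (h (c *: v) d + h (c *: v) d).

Let chi_char d : additive_character (chi d).
Proof.
split=> [|u v]; first by rewrite /chi scaler0 h0l addr0 char0.
by rewrite /chi -charD // scalerDr !hDl; congr mu; ring.
Qed.

(** Orthogonality of characters: [chi d] is trivial exactly when d lies in c V. *)
Let sum_chi d : \sum_v chi d v =
  (if `[< exists n, d = c *: n >] then #|V| else 0)%:R.
Proof.
case: asboolP => [[n ->]|dL].
  rewrite (eq_bigr (fun=> 1)) ?sumr_const // => v _.
  by rewrite /chi c_isotropic addr0 char0.
have /existsNP[v chiv] : ~ forall v, chi d v = 1 by move=> /c_lagrangian.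
exact: sum_character (chi_char d) chiv.
Qed.

(* Up to a scalar, the projection onto the line of [e w] along the [e w'] with
   [w' - w] outside [c V]. *)
Let P (w : V) : 'End(Y) :=
  \sum_v mu (- (h (c *: v) w + h (c *: v) w)) *: S (0, c *: v).

Let PE w w' : P w (e w') = (\sum_v chi (w' - w) v) *: e w'.
Proof.
rewrite sum_lfunE scaler_suml; apply: eq_bigr => v _.
rewrite scale_lfunE SE /= e_cong !scalerA -!charD //; congr (mu _ *: _).
have -> : h (c *: v) (w' - w) = h (c *: v) w' - h (c *: v) w.
  by apply: (addIr (h (c *: v) w)); rewrite -hDr !subrK.
by rewrite add0r; ring.
Qed.

Let P_line w z : exists a, P w z = a *: e w.
Proof.
apply/vlineP.
(* As an identity of operators the claim can be tested on the [e w']: those with w' outside w + c V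
   are killed, the others lie on the line of [e w]. *)
suff -> : P w = (projv <[e w]> \o P w)%VF by rewrite comp_lfunE memv_proj.
apply: e_ext => w'; rewrite comp_lfunE PE sum_chi.
case: asboolP => [[n wn]|_]; last by rewrite scale0r linear0.
by rewrite projv_id // memvZ // -[w'](subrK w) wn e_cong memvZ ?memv_line.
Qed.

Let sum_P : exists2 a, a != 0 & \sum_w P w = a *: \1%VF.
Proof.
(* This scalar is |V| |c V|, positive already by the term d = 0. *)
exists (\sum_d \sum_v chi d v).
  rewrite (eq_bigr _ (fun d _ => sum_chi d)) -natr_sum pnatr_eq0 -lt0n.
  rewrite (bigD1 0) //= asboolT ?addn_gt0; last by exists 0; rewrite scaler0.
  by apply/orP; left; apply/card_gt0P; exists 0.
apply: e_ext => w'; rewrite sum_lfunE scale_lfunE id_lfunE.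
rewrite (eq_bigr _ (fun w _ => PE w w')) -scaler_suml; congr (_ *: _).
by rewrite [RHS](reindex_inj (addrI w')) [RHS](reindex_inj oppr_inj).
Qed.

(** For z non-zero in a stable Z some [P w z] is non-zero, because the [P w] add up to a non-zero
    scalar. As [P w z] is a multiple of [e w], Z contains [e w], and translations carry it to every
    [e w']. *)
Lemma schrodinger_model_irreducible : irreducible S.
Proof.
split=> [Y0|Z stable].
  by have := memvf (e 0); rewrite Y0 memv0 (negPf e0).
have SZ k z : z \in Z -> S k z \in Z.
  by move=> zZ; apply: (subvP (stable k)); exact: memv_img.
have [->|Zn0] := eqVneq Z 0%VS; [by left|right].
have z0 := memv_pick Z; rewrite -vpick0 in Zn0.
set z := vpick Z in z0 Zn0.
have [a an0 sumP] := sum_P.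
have [w Pwz] : exists w, P w z != 0.
  apply/existsP; apply: contra_neqT an0 => /existsPn Pz.
  have := congr1 (fun F : 'End(Y) => F z) sumP.
  rewrite /= sum_lfunE big1 => [|w _].
    rewrite scale_lfunE id_lfunE => /esym/eqP.
    by rewrite scaler_eq0 (negPf Zn0) orbF => /eqP.
  by apply/eqP; have := Pz w; rewrite negbK.
have eZ : e w \in Z.
  have : P w z \in Z.
    by rewrite sum_lfunE memv_suml // => v _; rewrite scale_lfunE memvZ // SZ.
  have [b Pb] := P_line w z; rewrite Pb in Pwz *.
  move=> bZ; have bn0 : b != 0 by apply: contraNneq Pwz => ->; rewrite scale0r.
  by rewrite -[e w](scalerK bn0) memvZ.
apply/eqP; rewrite eqEsubv subvf; apply/subvP => y _.
suff -> : y = projv Z y by exact: memv_proj.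
rewrite -[LHS](id_lfunE y); apply: (congr1 (fun F : 'End(Y) => F y)).
apply: e_ext => w'; rewrite id_lfunE projv_id //.
have := SZ (0, w' - w) _ eZ; rewrite SE /= subrK.
set a0 := 0 + _ => Zw.
by rewrite -[e w'](scalerK (char_neq0 mu_char a0)) memvZ.
Qed.

End SchrodingerModel.

(** * The bottom layer *)

Section SubspaceRestriction.
Variables (F : fieldType) (X : vectType F) (s : seq X).
Notation U := (<<s>>%VS).

(** Defined for every [f] by projecting back with [vsproj]; it is the restriction of [f] once [f]
    maps [s] into the span. *)
Definition restrict_span (f : {linear X -> X}) : 'End(subvs_of U) :=
  linfun (vsproj U \o f \o vsval).

Lemma restrict_spanE (f : {linear X -> X}) :
  {in s, forall v, f v \in U} ->
  forall b, vsval (restrict_span f b) = f (vsval b).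
Proof.
move=> fs b; rewrite lfunE /= vsprojK //.
have : (linfun f @: U <= U)%VS.
  by rewrite limg_span; apply/span_subvP => _ /mapP[v vs ->]; rewrite lfunE fs.
by move/subvP; apply; rewrite -[f _]lfunE memv_img // subvsP.
Qed.

Lemma span_lfun_ext (Z : vectType F) (f g : 'Hom(subvs_of U, Z)) :
  {in s, forall v, f (vsproj U v) = g (vsproj U v)} -> f = g.
Proof.
move=> fg; apply/lfunP => b; apply/eqP; rewrite -subr_eq0.
have : (U <= lker ((f - g)%R \o linfun (vsproj U)))%VS.
  apply/span_subvP => v vs; rewrite memv_ker comp_lfunE add_lfunE opp_lfunE.
  by rewrite (lfunE (vsproj U)) fg // subrr.
move/subvP/(_ _ (subvsP b)).
by rewrite memv_ker comp_lfunE (lfunE (vsproj U)) /= vsvalK add_lfunE opp_lfunE.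
Qed.

Lemma vsvalZ a (u : subvs_of U) : vsval (a *: u) = a *: vsval u.
Proof. by []. Qed.

End SubspaceRestriction.

Section BottomLayer.
Variables (K : realType) (A : comNzRingType) (star : A -> A) (y half : A).
Hypothesis starD : forall a b, star (a + b) = star a + star b.
Hypothesis starM : forall a b, star (a * b) = star a * star b.
Hypothesis starK : involutive star.
Hypothesis star_y : star y = - y.
Hypothesis half2 : half + half = 1.
Variables (l m : nat) (V : finLmodType A) (b : 'I_m -> V) (h : V -> V -> A).
Hypothesis l_gt1 : (1 < l)%N.
Hypothesis y_nilp : y ^+ (2 * l) = 0.
Hypothesis ann_y : forall a, y * a = 0 -> exists a', a = y ^+ (2 * l).-1 * a'.
Hypothesis b_basis : is_basis b.
Hypothesis h_herm : hermitian_form star h.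
Hypothesis h_nondeg : nondegenerate_form h.
Variable mu : A -> K[i].
Hypothesis mu_char : additive_character mu.
Hypothesis mu_star : forall a, star a = a -> mu a = 1.
Hypothesis mu_prim : forall a, (forall a', mu (a * a') = 1) -> a = 0.
Variable T : {set V}.
Hypothesis T_transv : congruence_transversal (scaled V (y ^+ l)) T.
Variables (Abar : finComNzRingType) (piA : {rmorphism A -> Abar}).
Hypothesis piA_quot : quotient_map
  (fun a => exists a', a = y ^+ (2 * l.-1) * a') piA.
Variables (Vbar : finLmodType Abar) (piV : {linear V -> Vbar | piA \; *:%R}).
Hypothesis piV_quot : quotient_map
  (fun v => v \in scaled V (y ^+ (2 * l.-1))) piV.
Variable hbar : Vbar -> Vbar -> Abar.
Hypothesis hbar_def : forall u v, hbar (piV u) (piV v) = piA (h u v).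
Variable mubar : Abar -> K[i].
Hypothesis mubar_def : forall a, mubar (piA a) = mu (- (y ^+ 2 * a)).

Notation N := (scaled V (y ^+ l)).
Notation Bot := (weil_bot K T (scaled V y)).

Let star1 : star 1 = 1.
Proof. by rewrite -[RHS](starK 1) -[star 1 in RHS]mulr1 starM starK mul1r. Qed.

Let star_yX k : star (y ^+ k) = (- y) ^+ k.
Proof. by elim: k => [|k IH]; rewrite ?star1 // !exprS starM star_y IH. Qed.

Let star0 : star 0 = 0.
Proof. by apply: (addrI (star 0)); rewrite -starD !addr0. Qed.

Let h_yX k u v :
  h (y ^+ k *: u) (y ^+ k *: v) = (-1) ^+ k * (y ^+ (2 * k) * h u v).
Proof.
rewrite (hermZl starM h_herm) (hermZr h_herm) star_yX (exprNn y).
by rewrite mul2n -addnn exprD !mulrA.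
Qed.

Let h_y u v : h (y *: u) (y *: v) = - (y ^+ 2 * h u v).
Proof. by have := h_yX 1 u v; rewrite !expr1 mulN1r. Qed.

Let N0 : 0 \in N. Proof. by apply/imsetP; exists 0; rewrite ?scaler0. Qed.

Let NB u v : u \in N -> v \in N -> u - v \in N.
Proof.
move=> /imsetP[u' _ ->] /imsetP[v' _ ->].
by apply/imsetP; exists (u' - v'); rewrite ?scalerBr.
Qed.

Let N_isotropic u v : u \in N -> v \in N -> h u v = 0.
Proof.
by move=> /imsetP[u' _ ->] /imsetP[v' _ ->]; rewrite h_yX y_nilp mul0r mulr0.
Qed.

Let mem_N v : y ^+ l *: v \in N. Proof. exact: imset_f. Qed.

Notation E := (weil_vector h mu T_transv).
Let E_cong :=
  weil_vector_cong starD h_herm mu_char mu_star N0 NB N_isotropic T_transv.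
Let translationE :=
  weil_translation_vector starD h_herm mu_char mu_star N0 NB N_isotropic
    T_transv.

Let bot_seq :=
  [seq @weil_basis K _ V T v | v in [pred v | val v \in scaled V y]].

Let bot_seqP z : z \in bot_seq -> exists w, z = E (y *: w).
Proof.
move=> /imageP[t]; rewrite inE => /imsetP[w _ tw] ->; exists w.
by rewrite -tw (weil_vector_basis h_herm mu_star N0 T_transv).
Qed.

(** The two arguments of [E] differ by an element of y^l V, so [E_cong] applies; the norm h(y w, y
    w) drops out and [h_y] turns [mu] into [mubar]. *)
Let E_y u w : E (y *: (y ^+ l.-1 *: u + w)) =
  mubar (hbar (piV (y ^+ l.-1 *: u)) (piV w)) *: E (y *: w).
Proof.
rewrite (E_cong (v' := y *: w)); last first.
  by rewrite scalerDr addrK scalerA -exprS prednK ?mem_N //; lia.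
rewrite hbar_def mubar_def -h_y scalerDr (hermDl h_herm) (charD mu_char).
by rewrite (char_herm_norm h_herm mu_star) mulr1.
Qed.

Let piVZ a v : piV (a *: v) = piA a *: piV v. Proof. exact: linearZ_LR. Qed.
Let piV0 : piV 0 = 0. Proof. exact: raddf0. Qed.
Let piVD u v : piV (u + v) = piV u + piV v. Proof. exact: raddfD. Qed.
Let piVB u v : piV (u - v) = piV u - piV v. Proof. exact: raddfB. Qed.

Let mubarD a a' : mubar (a + a') = mubar a * mubar a'.
Proof.
have [u <-] := piA_quot.1 a; have [v <-] := piA_quot.1 a'.
by rewrite -rmorphD !mubar_def mulrDr opprD charD.
Qed.

Let mubar0 : mubar 0 = 1.
Proof. by rewrite -(rmorph0 piA) mubar_def mulr0 oppr0 char0. Qed.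

Let mubar_char : additive_character mubar. Proof. by split. Qed.

Let piV_eq0 v : piV v = 0 -> exists u, v = y ^+ l.-1 *: (y ^+ l.-1 *: u).
Proof.
move=> /piV_quot.2/imsetP[u _ ->]; exists u.
by rewrite scalerA -exprD addnn mul2n.
Qed.

Let piV_ker v : piV (y ^+ (2 * l.-1) *: v) = 0.
Proof. by apply/piV_quot.2; exact: imset_f. Qed.

Let hbarDl u u' v : hbar (u + u') v = hbar u v + hbar u' v.
Proof.
have [? <-] := piV_quot.1 u; have [? <-] := piV_quot.1 u'.
have [? <-] := piV_quot.1 v.
by rewrite -piVD !hbar_def (hermDl h_herm) rmorphD.
Qed.

Let hbarDr u v v' : hbar u (v + v') = hbar u v + hbar u v'.
Proof.
have [? <-] := piV_quot.1 u; have [? <-] := piV_quot.1 v'.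
have [? <-] := piV_quot.1 v.
by rewrite -piVD !hbar_def (hermDr h_herm) rmorphD.
Qed.

(** Vectors of the same class differ by y^(l-1) (y^(l-1) u), and the scalar in [E_y] is then trivial
    since y^(2(l-1)) u reduces to 0. *)
Let E_piV w w' : piV w = piV w' -> E (y *: w) = E (y *: w').
Proof.
move=> ww'; have [u uE] : exists u, w - w' = y ^+ l.-1 *: (y ^+ l.-1 *: u).
  by apply: piV_eq0; rewrite piVB ww' subrr.
rewrite -[w](subrK w') uE E_y scalerA -exprD addnn -mul2n piV_ker -piV0.
by rewrite hbar_def (herm0l h_herm) rmorph0 mubar0 scale1r.
Qed.

(** The representative of y w differs from it by an element of y^l V, so it lies in y V and its
    basis vector, proportional to E (y w), belongs to [Bot]. *)
Let E_bot w : E (y *: w) \in Bot.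
Proof.
have [t0 [[tT wt] _]] := T_transv (y *: w).
pose t : {v | v \in T} := Sub t0 tT.
have yt : exists u, val t = y *: (y ^+ l.-1 *: u + w).
  move: wt => /imsetP[u _ /eqP]; rewrite subr_eq => /eqP wE; exists (- u).
  rewrite scalerDr wE scalerA -exprS prednK; last by lia.
  by rewrite scalerN addrA addNr add0r.
have /memv_span tB : weil_basis K t \in bot_seq.
  by apply: image_f; rewrite inE; have [u ->] := yt; exact: imset_f.
move: tB; rewrite -(weil_vector_basis h_herm mu_star N0 T_transv).
have [u ->] := yt; rewrite E_y; set a := hbar _ _ => EB.
by rewrite -[E _](scalerK (char_neq0 mubar_char a)) memvZ.
Qed.

Let restrict_botE (f : {linear weil_module K T -> weil_module K T}) :
  (forall w, f (E (y *: w)) \in Bot) ->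
  forall b, vsval (restrict_span bot_seq f b) = f (vsval b).
Proof. by move=> fB; apply: restrict_spanE => _ /bot_seqP[w ->]; exact: fB. Qed.

(* The sections [lift] and [e] and the operators [bot_translation] are kept
   behind opaque sigma types: conversion would otherwise unfold them. *)
Fact lift_sig : {lift : Vbar -> V | cancel lift piV}.
Proof.
have ex (w : Vbar) : exists v, piV v == w.
  by have [v <-] := piV_quot.1 w; exists v.
by exists (fun w => xchoose (ex w)) => w; apply/eqP/(xchooseP (ex w)).
Qed.

Let lift := sval lift_sig.
Let liftK : cancel lift piV := svalP lift_sig.

Fact bot_vector_sig :
  {e : Vbar -> subvs_of Bot | forall v, vsval (e (piV v)) = E (y *: v)}.
Proof.
exists (fun w => vsproj Bot (E (y *: lift w))) => v.
by rewrite (vsprojK (E_bot _)); apply: E_piV; rewrite liftK.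
Qed.

Let e := sval bot_vector_sig.
Let val_e : forall v, vsval (e (piV v)) = E (y *: v) := svalP bot_vector_sig.

Let e_ext (f g : 'End(subvs_of Bot)) : (forall w, f (e w) = g (e w)) -> f = g.
Proof.
move=> fg; apply: span_lfun_ext => _ /bot_seqP[w ->].
have <- : e (piV w) = vsproj Bot (E (y *: w)); last exact: fg.
by apply: subvs_inj; rewrite val_e (vsprojK (E_bot _)).
Qed.

Let e0 : e 0 != 0.
Proof.
rewrite -[0](liftK 0); apply/eqP => /(congr1 vsval).
rewrite val_e linear0 => /eqP.
rewrite scaler_eq0 (negPf (char_neq0 mu_char _)) /= => /eqP/ffunP.
move/(_ (transversal_rep T_transv (y *: lift 0))); rewrite !ffunE eqxx => /eqP.
by rewrite oner_eq0.
Qed.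

(** The middle power of y: its square vanishes in [Abar]. *)
Let c := piA (y ^+ l.-1).

Let e_cong n w : e (c *: n + w) = mubar (hbar (c *: n) w) *: e w.
Proof.
rewrite -[n]liftK -[w]liftK -piVZ -piVD; apply: subvs_inj.
rewrite vsvalZ. rewrite !val_e. by rewrite E_y.
Qed.

Let c_isotropic u v : hbar (c *: u) (c *: v) = 0.
Proof.
rewrite -[u]liftK -[v]liftK -!piVZ hbar_def h_yX mulrCA.
by apply/piA_quot.2; eexists.
Qed.

Let h_inj := herm_inj h_herm h_nondeg.

(** It suffices that y^(l+1) kills a lift u of w, since then u is a multiple of y^(2l-(l+1)) =
    y^(l-1). Non-degeneracy and primitivity of [mu] reduce this to mu(y^(l+1) h(v, u) a) = 1. *)
Let c_lagrangian w :
  (forall v, mubar (hbar (c *: v) w + hbar (c *: v) w) = 1) ->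
  exists n, w = c *: n.
Proof.
rewrite -[w]liftK; set u := lift w => hu.
suff [n ->] : exists n, u = y ^+ (2 * l - l.+1) *: n.
  exists (piV n); rewrite -piVZ; congr (piV (_ ^+ _ *: _)); lia.
apply: (free_annihilator_expr ann_y b_basis); first by lia.
apply: h_inj => v; rewrite (herm0l h_herm) (herm_sym h_herm) (hermZr h_herm).
rewrite (mu_prim (a := y ^+ l.+1 * h v u)) ?star0 // => a.
(* [half] undoes the doubling in the hypothesis; the signs cancel those of [star] on y^(l-1) and of
   [mubar_def]. *)
pose t := - (-1) ^+ l.-1 * (half * a).
have := hu (piV (star t *: v)).
rewrite -piVZ hbar_def -(rmorphD piA) mubar_def.
rewrite !(hermZl starM h_herm) starK star_yX (exprNn y) => <-; congr mu.
have sgn : (-1) ^+ l.-1 * (-1) ^+ l.-1 = 1 :> A by rewrite -expr2 sqrr_sign.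
have yE : y ^+ l.+1 = y ^+ 2 * y ^+ l.-1 by rewrite -exprD; congr (_ ^+ _); lia.
rewrite yE /t.
transitivity ((half + half) * ((-1) ^+ l.-1 * (-1) ^+ l.-1) *
  (y ^+ 2 * y ^+ l.-1 * h v u * a)); first by rewrite half2 sgn !mul1r.
by move: (y ^+ l.-1) ((-1) ^+ l.-1) => z s; ring.
Qed.

(** If [mubar] is trivial on the multiples of the class of [a0], then y^2 [a0] = 0 by primitivity of
    [mu], so [a0] lies in y^(2l-2) A, the kernel of [piA]. *)
Lemma bot_character_primitive : primitive_character mubar.
Proof.
split=> // I [I0 Iid] muI.
apply/setP => a; rewrite inE; apply/idP/eqP => [aI|-> //].
have [a0 a0E] := piA_quot.1 a; rewrite -a0E.
have : - (y ^+ 2 * a0) = 0.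
  apply: mu_prim => a'; rewrite mulNr -mulrA -mubar_def; apply: muI.
  by rewrite rmorphM a0E mulrC -[_ * a]addr0; apply: Iid.
move=> /eqP; rewrite oppr_eq0 => /eqP ya; apply/piA_quot.2.
have [|a' ->] := annihilator_expr ann_y _ ya; first by lia.
by exists a'; congr (_ ^+ _ * _); lia.
Qed.

Fact bot_translation_sig : {S : Abar * Vbar -> 'End(subvs_of Bot) |
  forall k w, S k (e w) = mubar (k.1 + hbar k.2 w) *: e (k.2 + w)}.
Proof.
exists (fun k => mubar k.1 *:
  restrict_span bot_seq (weil_translation h mu T_transv (y *: lift k.2))).
move=> k w.
apply: subvs_inj; rewrite scale_lfunE !vsvalZ.
rewrite restrict_botE => [|v]; last first.
  by rewrite /= translationE -scalerDr memvZ ?E_bot.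
rewrite -[w]liftK val_e /= translationE -scalerDr h_y -mubar_def -hbar_def.
rewrite !liftK.
rewrite scalerA -mubarD; congr (_ *: _).
have -> : k.2 + w = piV (lift k.2 + lift w) by rewrite piVD !liftK.
by rewrite val_e.
Qed.

Let bot_translation := sval bot_translation_sig.
Let bot_translationE : forall k w,
    bot_translation k (e w) = mubar (k.1 + hbar k.2 w) *: e (k.2 + w) :=
  svalP bot_translation_sig.

Let h_unitary_N g v : unitary h g -> v \in N -> g v \in N.
Proof. by move=> gU /imsetP[w _ ->]; rewrite (unitaryZ _ _ gU) mem_N. Qed.

Let bot_action (g : {perm V}) w : unitary h g ->
  weil_action h mu N g (E (y *: w)) = E (y *: g w).
Proof.
move=> gU; rewrite -(unitaryZ _ _ gU).
apply: (weil_action_vector starD h_herm mu_char mu_star N0 NB N_isotropic).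
- exact: gU.2.
- by move=> u v; exact: unitaryB gU.
- by move=> w0; exact: h_unitary_N gU.
Qed.

(** W is left arbitrary off the unitary group of [hbar]. *)
Definition bot_induced (W : {perm Vbar} -> 'End(subvs_of Bot)) : Prop :=
  forall (g : {perm V}) (gbar : {perm Vbar}),
    unitary h g -> unitary hbar gbar ->
    (forall v, gbar (piV v) = piV (g v)) ->
    forall b, vsval (W gbar b) = weil_action h mu N g (vsval b).

Let unitary_lift (gbar : {perm Vbar}) : unitary hbar gbar ->
  exists2 g : {perm V}, unitary h g & forall v, gbar (piV v) = piV (g v).
Proof.
apply: (isometry_lift starD starM starK h_herm h_nondeg b_basis piV_quot.1
  hbar_def half2 (z := y ^+ 2)) => [a|v|a a'].
- move=> /piA_quot.2[a' ->]; rewrite mulrA -exprD.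
  by have -> : (2 + 2 * l.-1 = 2 * l)%N by [lia]; rewrite y_nilp mul0r.
- move/(free_annihilator_expr ann_y b_basis) => [|w ->]; first by lia.
  exists (y ^+ (2 * l.-1)), w; split; last by congr (_ ^+ _ *: _); lia.
  by apply/piA_quot.2; exists 1; rewrite mulr1.
- move=> /piA_quot.2[u ->] /piA_quot.2[v ->]; rewrite mulrACA -exprD.
  (* By [l_gt1] the predecessor [l.-2] is a true l - 2. *)
  have -> : (2 * l.-1 + 2 * l.-1 = 2 * l + 2 * l.-2)%N by lia.
  by rewrite exprD y_nilp !mul0r.
Qed.

Let h_extend_action (g : {perm V}) z :
  weil_extend (E \o g) z = weil_action h mu N g z.
Proof. by rewrite (weil_action_extend h mu T_transv). Qed.

(** Any two lifts of [gbar] act alike on [Bot], because E (y w) depends only on the class of w; so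
    one lift may be chosen. *)
Lemma bot_induced_exists : exists W, bot_induced W.
Proof.
suff /choice[W Wg] (gbar : {perm Vbar}) : exists F : 'End(subvs_of Bot),
    forall g : {perm V}, unitary h g -> (forall v, gbar (piV v) = piV (g v)) ->
    forall b, vsval (F b) = weil_action h mu N g (vsval b).
  by exists W => g gbar gU _; exact: Wg.
have [[g [gU gE]]|no] := pselect
    (exists g, unitary h g /\ forall v, gbar (piV v) = piV (g v)); last first.
  by exists 0 => g gU gE; case: no; exists g.
have [F FE] : exists F : {perm V} -> 'End(subvs_of Bot), forall g b,
    unitary h g -> vsval (F g b) = weil_action h mu N g (vsval b).
  exists (fun g => restrict_span bot_seq (weil_extend (E \o g))) => g' b' g'U.
  rewrite restrict_botE /= ?h_extend_action // => w.
  by rewrite h_extend_action bot_action // E_bot.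
exists (F g) => g' g'U g'E b'; rewrite -(FE g' b' g'U).
suff -> : F g = F g' by [].
apply: e_ext => w; apply: subvs_inj; rewrite -[w]liftK.
rewrite (FE g _ gU) (FE g' _ g'U) val_e (bot_action _ gU) (bot_action _ g'U).
by apply: E_piV; rewrite -gE g'E.
Qed.

(** * The induced action is a Weil representation *)

Section Induced.
Variable W : {perm Vbar} -> 'End(subvs_of Bot).
Hypothesis W_induced : bot_induced W.

Let W_vector gbar w : unitary hbar gbar -> W gbar (e w) = e (gbar w).
Proof.
move=> gbarU; have [g gU gE] := unitary_lift gbarU; apply: subvs_inj.
by rewrite (W_induced gU gbarU gE) -[w]liftK val_e (bot_action _ gU) gE val_e.
Qed.

Lemma bot_induced_rep : unitary_rep hbar W.
Proof.
split=> [|g k gU kU]; apply: e_ext => w.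
  by rewrite W_vector ?perm1 ?id_lfunE //; exact: unitary1.
by rewrite comp_lfunE !W_vector ?permM //; exact: unitaryM.
Qed.

Let W_inv g : unitary hbar g -> (W g^-1%g \o W g)%VF = \1%VF.
Proof.
move=> gU; apply: e_ext => w; have gVU := unitaryV gU.
by rewrite comp_lfunE !W_vector // permK id_lfunE.
Qed.

Let W_ker g : unitary hbar g -> lker (W g) == 0%VS.
Proof.
move=> /W_inv Wg; apply/lker0P; apply: (can_inj (g := W g^-1%g)) => z.
by rewrite -comp_lfunE Wg id_lfunE.
Qed.

Let W_intertwine g k : unitary hbar g ->
  (W g \o bot_translation k)%VF = (bot_translation (heis_act g k) \o W g)%VF.
Proof.
move=> gU; apply: e_ext => w.
rewrite !comp_lfunE bot_translationE (linearZ_LR (W g)) /=.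
rewrite (W_vector _ gU) (W_vector _ gU) bot_translationE.
rewrite [(heis_act g k).1]/= [(heis_act g k).2]/= gU.2; congr (_ *: e _).
by rewrite -[k.2]scale1r gU.1 !scale1r.
Qed.

(** The difference [v0] of the lifts has h(v0, v) in y^(2(l-1)) A for all v, so y^2 v0 = 0 by
    non-degeneracy and v0 lies in the kernel of [piV]. *)
Let hbar_inj u u' : (forall v, hbar u v = hbar u' v) -> u = u'.
Proof.
rewrite -[u]liftK -[u']liftK => uu'; apply/eqP; rewrite -subr_eq0 -piVB.
apply/eqP; set v0 := lift u - lift u'.
have [||w ->] := @free_annihilator_expr _ _ _ ann_y _ _ _ b_basis 2 v0.
- by lia.
- apply: h_inj => v.
  rewrite (herm0l h_herm) (hermZl starM h_herm) star_yX sqrrN.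
  have /piA_quot.2[a ->] : piA (h v0 v) = 0.
    by rewrite (hermBl h_herm) (rmorphB piA) -!hbar_def uu' subrr.
  rewrite mulrA -exprD.
  by have -> : (2 + 2 * l.-1 = 2 * l)%N by [lia]; rewrite y_nilp mul0r.
have -> : (2 * l - 2 = 2 * l.-1)%N by lia.
exact: piV_ker.
Qed.

Let hbar_semilin a : exists a', forall u v, hbar (a *: u) v = a' * hbar u v.
Proof.
have [a0 <-] := piA_quot.1 a; exists (piA (star a0)) => u v.
by rewrite -[u]liftK -[v]liftK -piVZ !hbar_def (hermZl starM h_herm) rmorphM.
Qed.

Lemma bot_induced_weil : weil_representation hbar mubar W.
Proof.
split; first exact: bot_induced_rep.
exists bot_translation; split; last first.
  (* [(W g)^-1] is a genuine right inverse because [W g] has trivial kernel. *)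
  move=> g k gU; rewrite W_intertwine // -comp_lfunA lker0_compfV ?W_ker //.
  by rewrite comp_lfun1r.
split.
- exact: (schrodinger_model_rep hbarDl hbarDr mubar_char e_ext
    bot_translationE).
- exact: (schrodinger_model_irreducible hbarDl hbarDr mubar_char c_isotropic
    c_lagrangian e0 e_ext e_cong bot_translationE).
- exact: (schrodinger_model_center hbarDl e_ext bot_translationE).
move=> g /(additive_isometry_unitary hbar_semilin hbar_inj) gU.
(* An additive isometry is unitary, so [W g] itself is the required equivalence. *)
by exists (W g); split=> [|k]; [apply/eqP/W_ker|exact: W_intertwine].
Qed.

End Induced.

End BottomLayer.

Theorem theorem8p6 (K : realType)
  (* the ring R *)
  (p l : nat) (R : finComNzRingType) (m_R : {set R}) (x : R)
  (p_char : p \in [pchar R]) (p_odd : odd p)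
  (R_local : local_ring m_R) (R_principal : principal_ring R)
  (m_R_gen : m_R = principal_ideal x) (m_R_nilp : nilpotency_degree m_R l)
  (l_gt1 : (1 < l)%N)
  (* the hermitian space V over A = R[t]/(t^2 - x) *)
  (m : nat) (m_ge1 : (1 <= m)%N) (V : finLmodType (ramified_ext x))
  (V_free : exists b : 'I_m -> V, is_basis b)
  (h : V -> V -> ramified_ext x)
  (h_herm : hermitian_form (@ram_conj R x) h) (h_nondeg : nondegenerate_form h)
  (* the characters lambda and mu *)
  (lambda : R -> K[i]) (lambda_prim : primitive_character lambda)
  (mu : ramified_ext x -> K[i]) (mu_def : forall a, mu a = lambda (ram_d a))
  (* the transversal T *)
  (T : {set V})
  (T_transv : congruence_transversal (scaled V (ram_y x ^+ l)) T)
  (* the quotients of A, V, h and mu *)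
  (Abar : finComNzRingType) (piA : {rmorphism ramified_ext x -> Abar})
  (piA_quot : quotient_map
     (fun a => exists b, a = ram_y x ^+ (2 * l.-1) * b) piA)
  (Vbar : finLmodType Abar) (piV : {linear V -> Vbar | piA \; *:%R})
  (piV_quot : quotient_map
     (fun v => v \in scaled V (ram_y x ^+ (2 * l.-1))) piV)
  (hbar : Vbar -> Vbar -> Abar)
  (hbar_def : forall u v, hbar (piV u) (piV v) = piA (h u v))
  (mubar : Abar -> K[i])
  (mubar_def : forall a, mubar (piA a) = mu (- (ram_y x ^+ 2 * a))) :
  let Bot := weil_bot K T (scaled V (ram_y x)) in
  (* W (gbar) is the restriction to Bot of the action of g, whenever g in U
     reduces to gbar in Ubar *)
  let induced (W : {perm Vbar} -> 'End(subvs_of Bot)) : Prop :=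
    forall (g : {perm V}) (gbar : {perm Vbar}),
      unitary h g -> unitary hbar gbar ->
      (forall v, gbar (piV v) = piV (g v)) ->
      forall b : subvs_of Bot,
        vsval (W gbar b) =
        weil_action h mu (scaled V (ram_y x ^+ l)) g (vsval b) in
  primitive_character mubar /\
  (exists W, unitary_rep hbar W /\ induced W) /\
  (forall W, induced W -> weil_representation hbar mubar W).
Proof.
rewrite m_R_gen in R_local m_R_nilp.
have ann := annihilator_generator R_local m_R_nilp.
have l_gt0 := ltnW l_gt1.
have [half half2] := odd_pchar_half p_char p_odd.
have [|halfA halfA2] := @odd_pchar_half (ramified_ext x) p _ p_odd.
  by rewrite pchar_qpoly.
have mu_char : additive_character mu.
  have [lambda0 lambdaD] := lambda_prim.1.
  split=> [|a a']; rewrite !mu_def /ram_d ?coef0 ?mulr0 // -lambdaD.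
  by rewrite ram_coef1D mulrDr.
have mu_star a : ram_conj a = a -> mu a = 1.
  (* A fixed element has a_1 = - a_1, so its image 2 a_1 under d is 0. *)
  move=> /(congr1 (fun b : ramified_ext x => b`_1)).
  rewrite ram_conj_coef1 => a1.
  by rewrite mu_def /ram_d mulr_natl mulr2n -{1}a1 addNr lambda_prim.1.1.
have mu_prim a : (forall a', mu (a * a') = 1) -> a = 0.
  move=> mua; apply: (ram_character_primitive (half := half) _ lambda_prim).
    by rewrite mulr_natr mulr2n.
  by move=> a'; rewrite -mu_def.
have y_nilp := ram_y_nilp (nilp_expr m_R_nilp).
have ann_y := ram_annihilator_y l_gt0 ann.
have [b b_basis] := V_free.
have weil W := bot_induced_weil (@ram_conjD R x) (@ram_conjM R x)
  (@ram_conjK R x) (ram_conj_y x) halfA2 l_gt1 y_nilp ann_y b_basis h_herm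
  h_nondeg mu_char mu_star mu_prim T_transv piA_quot piV_quot hbar_def mubar_def
  (W := W).
have [W0 W0_induced] := bot_induced_exists (@ram_conjD R x) (@ram_conjM R x)
  (@ram_conjK R x) (ram_conj_y x) l_gt1 y_nilp h_herm mu_char mu_star T_transv
  piA_quot piV_quot hbar_def mubar_def.
split; first exact: (bot_character_primitive (@ram_conjD R x) (@ram_conjM R x)
  (@ram_conjK R x) (ram_conj_y x) l_gt1 y_nilp ann_y h_herm mu_char mu_star
  mu_prim T_transv piA_quot piV_quot hbar_def mubar_def).
split; last by move=> W W_induced; apply: weil.
by exists W0; split=> //; case: (weil W0 W0_induced).
Qed.
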